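(* Let $(R,V,W,S)$ be a Morita context and let $T=\begin{pmatrix} R & V\\ W & S\end{pmatrix}$ be the associated matrix ring. The following conditions are equivalent: (1) $T$ is a $UJ$-ring; (2) $R$ and $S$ are $UJ$-rings, $VW\subseteq J(R)$ and $WV\subseteq J(S)$; (3) $R$ and $S$ are $UJ$-rings and $T/J(T)\simeq R/J(R)\oplus S/J(S)$ (as rings).
   Context: All rings are associative and unital. $U(R)$ is the group of units and $J(R)$ the Jacobson radical of a ring $R$; $R$ is a $UJ$-ring if $U(R)=1+J(R)$. A Morita context $(R,V,W,S)$ consists of rings $R,S$, an $(R,S)$-bimodule $V$, an $(S,R)$-bimodule $W$, and products $\phi:V\otimes_S W\to R$ and $\psi:W\otimes_R V\to S$ such that the set of matrices $\begin{pmatrix} R & V\\ W & S\end{pmatrix}$ forms an associative (unital) ring under the natural matrix operations defined with the help of $\phi$ and $\psi$. $VW$ and $WV$ denote the images of $\phi$ and $\psi$, i.e. the additive subgroups generated by all products $vw=\phi(v\otimes w)$, respectively $wv=\psi(w\otimes v)$, with $v\in V$, $w\in W$. *)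

(* Defs.v *)
From HB Require Import structures.
From mathcomp Require Import all_boot all_algebra.
From mathcomp Require Import boolp classical_sets.

Set Implicit Arguments.
Unset Strict Implicit.
Unset Printing Implicit Defensive.

Import GRing.Theory.
Local Open Scope ring_scope.
Local Open Scope classical_set_scope.
Local Open Scope quotient_scope.

(* Rings are [pzRingType]s, so that the zero ring is allowed and units need not
   be decidable. *)

Definition units (R : pzRingType) : set R :=
  [set x | exists y, y * x = 1 /\ x * y = 1].

Definition left_ideal (R : pzRingType) (I : set R) : Prop :=
  [/\ I 0, forall x y, I x -> I y -> I (x + y) & forall a x, I x -> I (a * x)].

Definition maximal_left_ideal (R : pzRingType) (M : set R) : Prop :=
  [/\ left_ideal M, M <> setT &
      forall I, left_ideal I -> M `<=` I -> I = M \/ I = setT].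

Definition jacobson (R : pzRingType) : set R :=
  \bigcap_(M in @maximal_left_ideal R) M.
Arguments jacobson : clear implicits.

Definition UJ_ring (R : pzRingType) : Prop :=
  @units R = [set 1 + j | j in jacobson R].

Definition ring_isomorphic (A B : pzRingType) : Prop :=
  exists f : {rmorphism A -> B}, bijective f.

Definition additive_subgroup (G : zmodType) (A : set G) : Prop :=
  A 0 /\ forall x y, A x -> A y -> A (x - y).

Definition subgroup_generated (G : zmodType) (X : set G) : set G :=
  smallest (@additive_subgroup G) X.

Section JacobsonIdeal.
Variable R : pzRingType.
Implicit Types (a x y : R) (M : set R).

Lemma left_idealN M x : left_ideal M -> M x -> M (- x).
Proof. by case=> _ _ MM Mx; rewrite -mulN1r; apply: MM. Qed.

Lemma jacobson0 : jacobson R 0.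
Proof. by move=> M [[M0 _ _] _ _]. Qed.

Lemma jacobsonB x y : jacobson R x -> jacobson R y -> jacobson R (x - y).
Proof.
move=> Jx Jy M Mmax; have [Mid _ _] := Mmax.
have [_ MD _] := Mid; apply: MD; first exact: Jx.
by apply: left_idealN => //; apply: Jy.
Qed.

Lemma jacobsonMl a x : jacobson R x -> jacobson R (a * x).
Proof.
move=> Jx M Mmax; have [[_ _ MM] _ _] := Mmax; apply: MM; exact: Jx.
Qed.

Lemma maximal_left_ideal_rtransl M a : maximal_left_ideal M -> ~ M a ->
  maximal_left_ideal [set x | M (x * a)].
Proof.
case=> Mid MT Mmax Ma; have [M0 MD MM] := Mid; split.
- split=> /= [|x y|b x]; first by rewrite mul0r.
  + by rewrite mulrDl; apply: MD.
  + by rewrite -mulrA; apply: MM.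
- move=> E; apply: Ma; have : [set x | M (x * a)] 1 by rewrite E.
  by rewrite /= mul1r.
move=> I [I0 ID IM] MI.
have [IM'|nIM] := pselect (I `<=` [set x | M (x * a)]).
  by left; apply/seteqP; split.
right; have [x Ix nMx] : exists2 x, I x & ~ M (x * a).
  apply: contrapT => nex; apply: nIM => x Ix /=.
  by apply: contrapT => nMx; apply: nex; exists x.
pose N := [set y : R | exists m b, M m /\ y = m + b * (x * a)].
have Nid : left_ideal N.
  split=> [|y z [m [b [Mm ->]]] [m' [b' [Mm' ->]]]|c y [m [b [Mm ->]]]].
  - by exists 0, 0; rewrite mul0r addr0.
  - by exists (m + m'), (b + b'); split; [apply: MD | rewrite mulrDl addrACA].
  - by exists (c * m), (c * b); split; [apply: MM | rewrite mulrDr mulrA].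
have MN : M `<=` N by move=> m Mm; exists m, 0; rewrite mul0r addr0.
have NT : N = setT.
  case: (Mmax N Nid MN) => // E; case: nMx; rewrite -E.
  by exists 0, 1; rewrite add0r mul1r.
apply/seteqP; split=> // y _.
have [m [b [Mm ya]]] : N (y * a) by rewrite NT.
rewrite -[y](subrK (b * x)); apply: ID; last exact: IM.
by apply: MI => /=; rewrite mulrBl ya -mulrA addrK.
Qed.

Lemma jacobsonMr a x : jacobson R x -> jacobson R (x * a).
Proof.
move=> Jx M Mmax; have [[_ _ MM] _ _] := Mmax.
have [Ma|nMa] := pselect (M a); first exact: MM.
exact: (Jx _ (maximal_left_ideal_rtransl Mmax nMa)).
Qed.

End JacobsonIdeal.

Section JacobsonQuotient.
Variable R : pzRingType.

Definition in_jacobson : {pred R} := fun x => `[< jacobson R x >].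

Fact in_jacobson_zmod_closed : zmod_closed in_jacobson.
Proof.
split=> [|x y]; rewrite !unfold_in; last first.
  by move=> /asboolP Jx /asboolP Jy; apply/asboolP; apply: jacobsonB.
apply/asboolP; exact: jacobson0.
Qed.

HB.instance Definition _ :=
  GRing.isZmodClosed.Build R in_jacobson in_jacobson_zmod_closed.

(* [Quotient.quot] only provides a multiplication on quotients of commutative
   rings, hence the instance below. *)
Definition jacobson_quot : Type := @Quotient.quot R in_jacobson.

HB.instance Definition _ := GRing.Zmodule.on jacobson_quot.
HB.instance Definition _ :=
  EqQuotient.copy jacobson_quot (@Quotient.quot R in_jacobson).

Definition jquot_one : jacobson_quot := lift_cst jacobson_quot 1.
Definition jquot_mul := lift_op2 jacobson_quot *%R.

Lemma jquot_eqP (x y : R) :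
  \pi_jacobson_quot x = \pi_jacobson_quot y <-> jacobson R (x - y).
Proof.
split=> [/eqmodP /asboolP //|Jxy].
by apply/eqmodP/asboolP.
Qed.

Lemma jquot_pi_mul (x y : R) :
  \pi_jacobson_quot (x * y) =
  jquot_mul (\pi_jacobson_quot x) (\pi_jacobson_quot y).
Proof.
unlock jquot_mul; apply/jquot_eqP; set x' := repr _; set y' := repr _.
have Jx : jacobson R (x - x') by apply/jquot_eqP; rewrite reprK.
have Jy : jacobson R (y' - y) by apply/jquot_eqP; rewrite reprK.
have -> : x * y - x' * y' = (x - x') * y - x' * (y' - y).
  by rewrite mulrBl mulrBr opprB addrA subrK.
by apply: jacobsonB; [apply: jacobsonMr | apply: jacobsonMl].
Qed.

Lemma jquot_pi_one : jquot_one = \pi_jacobson_quot 1.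
Proof. by unlock jquot_one. Qed.

Lemma jquot_pi_add (x y : R) :
  \pi_jacobson_quot (x + y) = \pi_jacobson_quot x + \pi_jacobson_quot y.
Proof. exact: (@Quotient.pi_add _ in_jacobson). Qed.

Fact jquot_mulA : associative jquot_mul.
Proof.
by move=> x y z; rewrite -[x]reprK -[y]reprK -[z]reprK -!jquot_pi_mul mulrA.
Qed.

Fact jquot_mul1r : left_id jquot_one jquot_mul.
Proof. by move=> x; rewrite -[x]reprK jquot_pi_one -jquot_pi_mul mul1r. Qed.

Fact jquot_mulr1 : right_id jquot_one jquot_mul.
Proof. by move=> x; rewrite -[x]reprK jquot_pi_one -jquot_pi_mul mulr1. Qed.

Fact jquot_mulDl : left_distributive jquot_mul +%R.
Proof.
move=> x y z; rewrite -[x]reprK -[y]reprK -[z]reprK.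
by rewrite -jquot_pi_add -!jquot_pi_mul mulrDl jquot_pi_add.
Qed.

Fact jquot_mulDr : right_distributive jquot_mul +%R.
Proof.
move=> x y z; rewrite -[x]reprK -[y]reprK -[z]reprK.
by rewrite -jquot_pi_add -!jquot_pi_mul mulrDr jquot_pi_add.
Qed.

HB.instance Definition _ := GRing.Zmodule_isPzRing.Build jacobson_quot
  jquot_mulA jquot_mul1r jquot_mulr1 jquot_mulDl jquot_mulDr.

End JacobsonQuotient.

HB.mixin Record Lmodule_isBimodule (R S : pzRingType) V of GRing.Lmodule R V := {
  ract : V -> S -> V;
  ractDl : forall u v s, ract (u + v) s = ract u s + ract v s;
  ractDr : forall v s t, ract v (s + t) = ract v s + ract v t;
  ractA : forall v s t, ract (ract v s) t = ract v (s * t);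
  ract1 : forall v, ract v 1 = v;
  scale_ract : forall a v s, ract (a *: v) s = a *: ract v s
}.

#[short(type="bimodType")]
HB.structure Definition Bimodule (R S : pzRingType) :=
  {V of GRing.Lmodule R V & Lmodule_isBimodule R S V}.

(* [balanced_product V W f] says that [v (x) w |-> f v w] is a well-defined
   additive map from the tensor product of [V] and [W] over [S] to [A]. *)
Record balanced_product (R S : pzRingType) (V : bimodType R S)
    (W : bimodType S R) (A : zmodType) (f : V -> W -> A) : Prop := {
  balancedDl : forall v v' w, f (v + v') w = f v w + f v' w;
  balancedDr : forall v w w', f v (w + w') = f v w + f v w';
  balancedA : forall v s w, f (ract v s) w = f v (s *: w)
}.

Record morita_mx (R S : pzRingType) (V : bimodType R S) (W : bimodType S R) :=
  MoritaMx { mx_ul : R; mx_ur : V; mx_dl : W; mx_dr : S }.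
Arguments MoritaMx {R S V W}.

Definition morita_mul (R S : pzRingType) (V : bimodType R S)
    (W : bimodType S R) (phi : V -> W -> R) (psi : W -> V -> S)
    (A B : morita_mx V W) : morita_mx V W :=
  let: MoritaMx r v w s := A in
  let: MoritaMx r' v' w' s' := B in
  MoritaMx (r * r' + phi v w')     (r *: v' + ract v s')
           (ract w r' + s *: w')   (psi w v' + s * s').

(* The other ring axioms for the matrices follow from the bimodule axioms and
   the additivity of the products. *)
Record morita_context (R S : pzRingType) (V : bimodType R S)
    (W : bimodType S R) := MoritaContext {
  mc_phi : V -> W -> R;
  mc_psi : W -> V -> S;
  mc_phi_balanced : balanced_product mc_phi;
  mc_psi_balanced : balanced_product mc_psi;
  mc_mulA : associative (morita_mul mc_phi mc_psi)
}.

Section MoritaZmodule.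
Variables (R S : pzRingType) (V : bimodType R S) (W : bimodType S R).
Local Notation mx := (morita_mx V W).

Definition morita_tuple (A : mx) : R * V * W * S :=
  (mx_ul A, mx_ur A, mx_dl A, mx_dr A).
Definition tuple_morita (p : R * V * W * S) : mx :=
  let: (r, v, w, s) := p in MoritaMx r v w s.
Fact morita_tupleK : cancel morita_tuple tuple_morita.
Proof. by case. Qed.

HB.instance Definition _ := Choice.copy mx (can_type morita_tupleK).

Definition morita_zero : mx := MoritaMx 0 0 0 0.
Definition morita_opp (A : mx) : mx :=
  let: MoritaMx r v w s := A in MoritaMx (- r) (- v) (- w) (- s).
Definition morita_add (A B : mx) : mx :=
  let: MoritaMx r v w s := A in
  let: MoritaMx r' v' w' s' := B in
  MoritaMx (r + r') (v + v') (w + w') (s + s').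

Fact morita_addA : associative morita_add.
Proof. by move=> [? ? ? ?] [? ? ? ?] [? ? ? ?]; rewrite /= !addrA. Qed.
Fact morita_addC : commutative morita_add.
Proof.
by move=> [r v w s] [? ? ? ?]; rewrite /= (addrC r) (addrC v) (addrC w) (addrC s).
Qed.
Fact morita_add0 : left_id morita_zero morita_add.
Proof. by move=> [? ? ? ?]; rewrite /= !add0r. Qed.
Fact morita_addN : left_inverse morita_zero morita_opp morita_add.
Proof. by move=> [? ? ? ?]; rewrite /= !addNr. Qed.

HB.instance Definition _ := GRing.isZmodule.Build mx
  morita_addA morita_addC morita_add0 morita_addN.

End MoritaZmodule.

Section MoritaRing.
Variables (R S : pzRingType) (V : bimodType R S) (W : bimodType S R).

(* The phantom argument carries the products defining the multiplication. *)
Definition morita_ring of morita_context V W : Type := morita_mx V W.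

Variable C : morita_context V W.
Local Notation T := (morita_ring C).

HB.instance Definition _ := GRing.Zmodule.copy T (morita_mx V W).

Definition morita_one : T := MoritaMx 1 0 0 1.
Definition morita_ring_mul : T -> T -> T :=
  morita_mul (mc_phi C) (mc_psi C).

Fact ract0r (R' S' : pzRingType) (U : bimodType R' S') (u : U) :
  ract u (0 : S') = 0.
Proof. by apply: (addrI (ract u 0)); rewrite -ractDr !addr0. Qed.
Fact ract0l (R' S' : pzRingType) (U : bimodType R' S') (s : S') :
  ract (0 : U) s = 0.
Proof. by apply: (addrI (ract 0 s)); rewrite -ractDl !addr0. Qed.

Fact mc_phi0l w : mc_phi C 0 w = 0.
Proof.
apply: (addrI (mc_phi C 0 w)).
by rewrite -(balancedDl (mc_phi_balanced C)) !addr0.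
Qed.
Fact mc_phi0r v : mc_phi C v 0 = 0.
Proof.
apply: (addrI (mc_phi C v 0)).
by rewrite -(balancedDr (mc_phi_balanced C)) !addr0.
Qed.
Fact mc_psi0l v : mc_psi C 0 v = 0.
Proof.
apply: (addrI (mc_psi C 0 v)).
by rewrite -(balancedDl (mc_psi_balanced C)) !addr0.
Qed.
Fact mc_psi0r w : mc_psi C w 0 = 0.
Proof.
apply: (addrI (mc_psi C w 0)).
by rewrite -(balancedDr (mc_psi_balanced C)) !addr0.
Qed.

Fact morita_mul1r : left_id morita_one morita_ring_mul.
Proof.
move=> [r v w s]; rewrite /morita_ring_mul /= !mul1r !scale1r mc_phi0l mc_psi0l.
by rewrite !ract0l !addr0 !add0r.
Qed.
Fact morita_mulr1 : right_id morita_one morita_ring_mul.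
Proof.
move=> [r v w s]; rewrite /morita_ring_mul /= !mulr1 !scaler0 mc_phi0r mc_psi0r.
by rewrite !ract1 !addr0 !add0r.
Qed.
Fact morita_mulDl : left_distributive morita_ring_mul +%R.
Proof.
move=> [? ? ? ?] [? ? ? ?] [? ? ? ?]; rewrite /morita_ring_mul /=.
rewrite !mulrDl !scalerDl !ractDl.
rewrite (balancedDl (mc_phi_balanced C)) (balancedDl (mc_psi_balanced C)).
by congr MoritaMx; rewrite addrACA.
Qed.
Fact morita_mulDr : right_distributive morita_ring_mul +%R.
Proof.
move=> [? ? ? ?] [? ? ? ?] [? ? ? ?]; rewrite /morita_ring_mul /=.
rewrite !mulrDr !scalerDr !ractDr.
rewrite (balancedDr (mc_phi_balanced C)) (balancedDr (mc_psi_balanced C)).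
by congr MoritaMx; rewrite addrACA.
Qed.

HB.instance Definition _ := GRing.Zmodule_isPzRing.Build T
  (mc_mulA C : associative morita_ring_mul)
  morita_mul1r morita_mulr1 morita_mulDl morita_mulDr.

Definition morita_VW : set R :=
  subgroup_generated [set r | exists v w, r = mc_phi C v w].
Definition morita_WV : set S :=
  subgroup_generated [set s | exists w v, s = mc_psi C w v].

End MoritaRing.

(* Main.v *)
Require Import Defs.
From mathcomp Require Import all_boot all_algebra.
From mathcomp Require Import boolp classical_sets.
From HB Require Import structures.

(** The three conditions are proved in a cycle. Three facts about the Jacobson
    radical carry the argument: [x] lies in [J(R)] iff every [1 + a x] is left
    invertible ([jacobsonP], which rests on Zorn's lemma), so elements that are
    invertible modulo [J(R)] are invertible ([units_mod_jacobson]), and hence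
    [R] is a UJ-ring iff [1] is the only unit of [R/J(R)] ([UJ_quotP]).

    (1) implies (2). [R] and [S] are corners of [T], and the UJ property passes
    to corners: a unit [u] of [e T e] extends to the unit [u + (1 - e)] of [T],
    and compressing [J(T)] to the corner lands in the radical of the corner
    ([corner_UJ]). The unipotent matrices with one off-diagonal entry are units
    of [T], so in a UJ-ring [T] every purely off-diagonal matrix lies in
    [J(T)]; multiplying two of them puts [VW] in [J(R)] and [WV] in [J(S)]
    ([UJ_VW], [UJ_WV]).

    (2) implies (3). If [VW] and [WV] lie in the radicals, then a matrix whose
    diagonal entries are congruent to [1] can be reduced to the identity by
    row operations, because the Schur complement stays congruent to [1]
    ([mx_linv]). So [J(T)] consists of all matrices whose diagonal lies in
    [J(R)] and [J(S)] ([mx_jacobsonP]). Modulo the radicals the diagonal of a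
    product is the product of the diagonals, so taking diagonals induces the
    isomorphism ([morita_quot_isom]).

    (3) implies (1). By (3), [T/J(T)] is isomorphic to a product of two rings
    whose only unit is [1], so its only unit is [1], and [UJ_quotP] applies
    to [T]. *)

Set Implicit Arguments.
Unset Strict Implicit.
Unset Printing Implicit Defensive.

Local Open Scope ring_scope.
Local Open Scope classical_set_scope.

Import GRing.Theory.
Local Open Scope quotient_scope.

(** * Quasi-regularity of the Jacobson radical *)

(** Zorn's lemma applies because a union of proper left ideals still misses
    [1]. *)
Lemma proper_left_ideal_maximal (R : pzRingType) (I : set R) :
  left_ideal I -> ~ I 1 -> exists M, maximal_left_ideal M /\ I `<=` M.
Proof.
move=> Iid nI1.
(* The empty set has to satisfy [P], being the union of the empty chain. *)
pose P (A : set R) := A !=set0 -> [/\ left_ideal A, I `<=` A & ~ A 1].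
have [|A [PA Amax]] := @Zorn_bigcup R P.
  move=> F FP Ftot [x0 [X0 FX0 X0x0]].
  have PF X x : F X -> X x -> [/\ left_ideal X, I `<=` X & ~ X 1].
    by move=> FX Xx; apply: FP => //; exists x.
  have [[X00 _ _] IX0 _] := PF _ _ FX0 X0x0.
  split; last by move=> [X FX X1]; have [_ _] := PF _ _ FX X1; apply.
    split; first by exists X0.
    - move=> x y [X FX Xx] [Y FY Yy].
      have [[_ XD _] _ _] := PF _ _ FX Xx; have [[_ YD _] _ _] := PF _ _ FY Yy.
      have [XY|YX] := Ftot _ _ FX FY.
      + by exists Y => //; apply: YD => //; apply: XY.
      + by exists X => //; apply: XD => //; apply: YX.
    - move=> a x [X FX Xx]; have [[_ _ XM] _ _] := PF _ _ FX Xx.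
      by exists X => //; apply: XM.
  by move=> y Iy; exists X0 => //; apply: IX0.
have [I0 _ _] := Iid.
have A0 : A !=set0.
  apply: contrapT => nA.
  have AE x : ~ A x by move=> Ax; apply: nA; exists x.
  apply: (Amax I); last by move=> _; split.
  by split=> [x /AE//|/(_ _ I0)]; apply: AE.
have [Aid IA nA1] := PA A0.
exists A; split=> //; split=> // [AT|B Bid AB]; first by apply: nA1; rewrite AT.
have [B1|nB1] := pselect (B 1).
  right; apply/seteqP; split=> // x _.
  by rewrite -[x]mulr1; case: Bid => _ _; apply.
left; apply/seteqP; split=> //; apply: contrapT => nBA.
apply: (Amax B); first by split.
by move=> _; split=> //; apply: subset_trans AB.
Qed.

(** If [R (1 + a x)] is proper, a maximal left ideal above it contains [x] as
    soon as [x] lies in [J(R)], and then it contains [1]. Conversely, a maximal left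
    ideal [M] missing [x] gives [1 = m + b x] with [m] in [M], so [m = 1 - b x] is left invertible. *)
Lemma jacobsonP (R : pzRingType) (x : R) :
  jacobson R x <-> forall a, exists y, y * (1 + a * x) = 1.
Proof.
split=> [Jx a|linv M [Mid MT Mmax]].
  pose L := [set z | exists y, z = y * (1 + a * x)].
  apply: contrapT => nex.
  have [||M [Mmax LM]] := @proper_left_ideal_maximal R L.
  - split=> [|_ _ [y ->] [z ->]|b _ [y ->]].
    + by exists 0; rewrite mul0r.
    + by exists (y + z); rewrite mulrDl.
    + by exists (b * y); rewrite mulrA.
  - by case=> y yE; apply: nex; exists y.
  have [[M0 MD MM] MT _] := Mmax.
  apply: MT; apply/seteqP; split=> // z _; rewrite -[z]mulr1; apply: (MM).
  rewrite -[1](addrK (a * x)); apply: MD; first by apply: LM; exists 1; rewrite mul1r.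
  by rewrite -mulNr; apply: MM; apply: Jx.
apply: contrapT => nMx; have [M0 MD MM] := Mid.
pose N := [set z | exists m b, M m /\ z = m + b * x].
have Nid : left_ideal N.
  split=> [|_ _ [m [b [Mm ->]]] [n [c [Mn ->]]]|c _ [m [b [Mm ->]]]].
  - by exists 0, 0; rewrite mul0r addr0.
  - by exists (m + n), (b + c); split; [apply: MD|rewrite mulrDl addrACA].
  - by exists (c * m), (c * b); split; [apply: MM|rewrite mulrDr mulrA].
have MN : M `<=` N by move=> m Mm; exists m, 0; rewrite mul0r addr0.
have [NM|NT] := Mmax N Nid MN.
  by apply: nMx; rewrite -NM; exists 0, 1; rewrite add0r mul1r.
have [m [b [Mm mE]]] : N 1 by rewrite NT.
have [y yE] := linv (- b); apply: MT; apply/seteqP; split=> // z _.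
rewrite -[z]mulr1 -yE mulrA; apply: (MM).
by rewrite mulNr {1}mE addrK.
Qed.

Lemma jacobsonD (R : pzRingType) (x y : R) :
  jacobson R x -> jacobson R y -> jacobson R (x + y).
Proof.
move=> Jx Jy; rewrite -[y]opprK; apply: jacobsonB => //.
by rewrite -sub0r; apply: jacobsonB => //; apply: jacobson0.
Qed.

Lemma subgroup_generated_sub_jacobson (Q : pzRingType) (X : set Q) :
  X `<=` jacobson Q -> subgroup_generated X `<=` jacobson Q.
Proof.
move=> XJ; apply: smallest_sub => //; split; first exact: jacobson0.
by move=> x y; apply: jacobsonB.
Qed.

(** The left inverse [y] of [1 + x] is [1 - y x], which is again left
    invertible; thus [y] is invertible, and so is [1 + x]. *)
Lemma jacobson_unit (R : pzRingType) (x : R) : jacobson R x -> @units R (1 + x).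
Proof.
move=> Jx; have [y] := (jacobsonP _).1 Jx 1; rewrite mul1r => yE.
have [z] := (jacobsonP _).1 Jx (- y).
have -> : 1 + - y * x = y by rewrite -{1}yE mulrDr mulr1 mulNr addrK.
move=> zE; exists y; split=> //.
by have -> : 1 + x = z by rewrite -[LHS]mul1r -{1}zE -mulrA yE mulr1.
Qed.

(** Both [y x] and [x y] lie in [1 + J(R)], hence are units, so [x] has a left
    and a right inverse. *)
Lemma units_mod_jacobson (R : pzRingType) (x y : R) :
  jacobson R (y * x - 1) -> jacobson R (x * y - 1) -> @units R x.
Proof.
move=> /jacobson_unit[a [aE _]] /jacobson_unit[b [_ bE]].
rewrite addrC subrK in aE; rewrite addrC subrK in bE.
have E : a * y = y * b.
  by rewrite -[LHS]mulr1 -bE 2!mulrA -(mulrA a) aE mul1r.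
by exists (a * y); split; [rewrite -mulrA|rewrite E mulrA].
Qed.

Lemma UJ_ringP (R : pzRingType) :
  UJ_ring R <-> forall u, @units R u -> jacobson R (u - 1).
Proof.
rewrite /UJ_ring; split=> [-> _ [j Jj <-]|UJ]; first by rewrite addrC addKr.
apply/seteqP; split=> [u /UJ Ju|_ [j Jj <-]]; last exact: jacobson_unit.
by exists (u - 1) => //; rewrite addrC subrK.
Qed.

(** * The UJ property and the units of the semiprimitive quotient *)

Lemma jquot_piM (R : pzRingType) : {morph \pi_(jacobson_quot R) : x y / x * y}.
Proof. exact: jquot_pi_mul. Qed.

Lemma jquot_piB (R : pzRingType) : {morph \pi_(jacobson_quot R) : x y / x - y}.
Proof. exact: (raddfB \pi_(jacobson_quot R)). Qed.

Lemma jquot_pi1 (R : pzRingType) : \pi_(jacobson_quot R) 1 = 1.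
Proof. by rewrite -jquot_pi_one. Qed.

Lemma jquot_pi1P (R : pzRingType) (x : R) :
  \pi_(jacobson_quot R) x = 1 <-> jacobson R (x - 1).
Proof. by rewrite -jquot_pi1; apply: jquot_eqP. Qed.

(** Units of [R/J(R)] lift to units of [R], so triviality of the unit group of
    the quotient says exactly that units of [R] are congruent to [1]. *)
Lemma UJ_quotP (R : pzRingType) :
  UJ_ring R <-> forall u, @units (jacobson_quot R) u -> u = 1.
Proof.
rewrite UJ_ringP; split=> [UJ u [v []]|UQ u [v [vu uv]]].
  rewrite -[u]reprK -[v]reprK -!jquot_piM => /jquot_pi1P Jvu /jquot_pi1P Juv.
  by apply/jquot_pi1P; apply: UJ; apply: units_mod_jacobson Jvu Juv.
apply/jquot_pi1P; apply: UQ; exists (\pi_(jacobson_quot R) v).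
by rewrite -!jquot_piM vu uv; split; apply/jquot_pi1P; rewrite subrr; apply: jacobson0.
Qed.

Lemma units_pair_trivial (A B : pzRingType) :
  (forall u, @units A u -> u = 1) -> (forall u, @units B u -> u = 1) ->
  forall u, @units (A * B)%type u -> u = 1.
Proof.
move=> UA UB [a b] [[c d] [[ca db] [ac bd]]].
by congr pair; [apply: UA; exists c | apply: UB; exists d].
Qed.

Lemma units_trivial_isom (A B : pzRingType) : ring_isomorphic A B ->
  (forall u, @units B u -> u = 1) -> forall u, @units A u -> u = 1.
Proof.
move=> [f /bij_inj f_inj] UB u [v [vu uv]].
by apply: f_inj; rewrite rmorph1; apply: UB; exists (f v); rewrite -!rmorphM vu uv rmorph1.
Qed.

(** * Corners *)

(** This is the inclusion [iota] of a corner [e T e], with [e = iota 1], together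
    with the compression [p : A |-> e A e]. The unital ring [R] is kept apart
    from [T] because its unit is [e] and not the unit of [T]. *)
Record corner (T R : pzRingType) (iota : {additive R -> T})
    (p : {additive T -> R}) : Prop := {
  cornerM : {morph iota : x y / x * y};
  corner1 : p 1 = 1;
  cornerMr : forall A x, p (A * iota x) = p A * x;
  cornerP : forall A, iota (p A) = iota 1 * A * iota 1
}.

Section Corner.
Variables (T R : pzRingType) (iota : {additive R -> T}).
Variables (p : {additive T -> R}) (crn : corner iota p).

(** [J(T)] is an ideal, so it contains [e A e]; compressing a left inverse of
    [1 + a (e A e)] to the corner gives a left inverse there. *)
Lemma corner_jacobson A : jacobson T A -> jacobson R (p A).
Proof.
move=> JA; apply/jacobsonP => a.
have /jacobsonP/(_ (iota a))[B BE] : jacobson T (iota (p A)).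
  by rewrite (cornerP crn); apply: jacobsonMr; apply: jacobsonMl.
exists (p B); move: (congr1 p BE).
by rewrite -(cornerM crn) !mulrDr !mulr1 raddfD (cornerMr crn) (corner1 crn).
Qed.

Lemma cornerK : cancel iota p.
Proof. by move=> x; rewrite -[iota x]mul1r (cornerMr crn) (corner1 crn) mul1r. Qed.

(** A unit [u] of the corner [e T e] extends to the unit [u + (1 - e)] of [T],
    which differs from [1] by [u - e]. *)
Lemma corner_UJ : UJ_ring T -> UJ_ring R.
Proof.
rewrite !UJ_ringP => UJT u [v [vu uv]].
have inv x y : x * y = 1 -> (1 + iota (x - 1)) * (1 + iota (y - 1)) = 1.
  move=> xy.
  have E : (y - 1) + ((x - 1) + (x - 1) * (y - 1)) = 0.
    by rewrite mulrBr mulr1 [X in _ + X]addrC subrK mulrBl xy mul1r addrA subrK subrr.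
  by rewrite mulrDl mul1r mulrDr mulr1 -(cornerM crn) -addrA -!raddfD E raddf0 addr0.
have /UJT : @units T (1 + iota (u - 1)).
  by exists (1 + iota (v - 1)); split; apply: inv.
by rewrite addrC addKr => /corner_jacobson; rewrite cornerK.
Qed.

End Corner.

(** * The two diagonal corners of a Morita context *)

Section Morita.
Variables (R S : pzRingType) (V : bimodType R S) (W : bimodType S R).
Variable C : morita_context V W.
Local Notation T := (morita_ring C).
Local Notation phi := (mc_phi C).
Local Notation psi := (mc_psi C).
Local Notation mx r v w s := (MoritaMx r v w s : T).

Lemma mx_mulE r v w s r' v' w' s' :
  mx r v w s * mx r' v' w' s' =
  mx (r * r' + phi v w') (r *: v' + ract v s')
     (ract w r' + s *: w') (psi w v' + s * s').
Proof. by []. Qed.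

Definition ul_mx (r : R) : T := MoritaMx r 0 0 0.
Definition dr_mx (s : S) : T := MoritaMx 0 0 0 s.
Definition ul (A : T) : R := mx_ul A.
Definition dr (A : T) : S := mx_dr A.

Fact ul_mx_is_zmod_morphism : zmod_morphism ul_mx.
Proof. by move=> x y; congr MoritaMx; rewrite subrr. Qed.
Fact dr_mx_is_zmod_morphism : zmod_morphism dr_mx.
Proof. by move=> x y; congr MoritaMx; rewrite subrr. Qed.
Fact ul_is_zmod_morphism : zmod_morphism ul.
Proof. by move=> [? ? ? ?] [? ? ? ?]. Qed.
Fact dr_is_zmod_morphism : zmod_morphism dr.
Proof. by move=> [? ? ? ?] [? ? ? ?]. Qed.

HB.instance Definition _ := GRing.isZmodMorphism.Build R T ul_mx
  ul_mx_is_zmod_morphism.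
HB.instance Definition _ := GRing.isZmodMorphism.Build S T dr_mx
  dr_mx_is_zmod_morphism.
HB.instance Definition _ := GRing.isZmodMorphism.Build T R ul
  ul_is_zmod_morphism.
HB.instance Definition _ := GRing.isZmodMorphism.Build T S dr
  dr_is_zmod_morphism.

Lemma ractNl (R' S' : pzRingType) (U : bimodType R' S') (u : U) (s : S') :
  ract (- u) s = - ract u s.
Proof. by apply/eqP; rewrite -addr_eq0 -ractDl addNr ract0l. Qed.

Lemma mc_psiNl w v : psi (- w) v = - psi w v.
Proof.
apply/eqP.
by rewrite -addr_eq0 -(balancedDl (mc_psi_balanced C)) addNr mc_psi0l.
Qed.

Let ract0 := (ract0r, ract0l).
Let pair0 := (mc_phi0l, mc_phi0r, mc_psi0l, mc_psi0r).

Lemma ul_corner : corner ul_mx ul.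
Proof.
split=> [x y||[r v w s] x|[r v w s]] //=.
- rewrite /ul_mx mx_mulE.
  by rewrite !(pair0, ract0, scaler0, scale0r, mulr0, addr0).
- by rewrite pair0 addr0.
- rewrite /ul_mx !mx_mulE /=.
  by rewrite !(pair0, ract0, scaler0, scale0r, mulr0, mul0r, addr0, mulr1, mul1r).
Qed.

Lemma dr_corner : corner dr_mx dr.
Proof.
split=> [x y||[r v w s] x|[r v w s]] //=.
- rewrite /dr_mx mx_mulE.
  by rewrite !(pair0, ract0, scaler0, scale0r, mulr0, addr0, add0r).
- by rewrite pair0 add0r.
- rewrite /dr_mx !mx_mulE /=.
  by rewrite !(pair0, ract0, scaler0, scale0r, mulr0, mul0r, addr0, add0r, mulr1, mul1r).
Qed.

(** * From a UJ Morita ring to radical products *)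

(** Adding [1] gives a unipotent matrix, whose inverse is obtained by negating
    the off-diagonal entry. *)
Lemma UJ_offdiag v w : UJ_ring T ->
  jacobson T (mx 0 v 0 0) /\ jacobson T (mx 0 0 w 0).
Proof.
move=> /UJ_ringP UJT; split.
  have -> : mx 0 v 0 0 = mx 1 v 0 1 - 1.
    by congr MoritaMx; rewrite ?subrr ?subr0.
  apply: UJT; exists (mx 1 (- v) 0 1).
  rewrite !mx_mulE !(pair0, ract0, scaler0, scale0r, scale1r, ract1, mulr1, addr0, add0r).
  by rewrite subrr addNr.
have -> : mx 0 0 w 0 = mx 1 0 w 1 - 1.
  by congr MoritaMx; rewrite ?subrr ?subr0.
apply: UJT; exists (mx 1 0 (- w) 1).
rewrite !mx_mulE !(pair0, ract0, scaler0, scale0r, scale1r, ract1, mulr1, addr0, add0r).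
by rewrite subrr addNr.
Qed.

Lemma UJ_VW : UJ_ring T -> morita_VW C `<=` jacobson R.
Proof.
move=> UJT; apply: subgroup_generated_sub_jacobson => _ [v [w ->]].
have -> : phi v w = ul (mx 0 v 0 0 * mx 0 0 w 0) by rewrite mx_mulE /ul /= mul0r add0r.
apply: (corner_jacobson ul_corner); apply: jacobsonMr.
by have [] := UJ_offdiag v w UJT.
Qed.

Lemma UJ_WV : UJ_ring T -> morita_WV C `<=` jacobson S.
Proof.
move=> UJT; apply: subgroup_generated_sub_jacobson => _ [w [v ->]].
have -> : psi w v = dr (mx 0 0 w 0 * mx 0 v 0 0) by rewrite mx_mulE /dr /= mul0r addr0.
apply: (corner_jacobson dr_corner); apply: jacobsonMr.
by have [] := UJ_offdiag v w UJT.
Qed.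

(** * The radical of the Morita ring when the products are radical *)

Section VW.
Hypotheses (VWJ : morita_VW C `<=` jacobson R) (WVJ : morita_WV C `<=` jacobson S).

Lemma phi_jacobson v w : jacobson R (phi v w).
Proof. by apply: VWJ => A [_ +]; apply; exists v, w. Qed.

Lemma psi_jacobson w v : jacobson S (psi w v).
Proof. by apply: WVJ => A [_ +]; apply; exists w, v. Qed.

(** Gaussian elimination: the radical hypothesis keeps the Schur complement [t]
    of the upper left entry congruent to [1], hence invertible. *)
Lemma mx_linv r v w s : jacobson R (r - 1) -> jacobson S (s - 1) ->
  exists B, B * mx r v w s = 1.
Proof.
move=> Jr Js.
have [c [cr _]] : @units R r by rewrite -(subrK 1 r) addrC; apply: jacobson_unit.
pose t := s - psi (ract w c) v.
have [d [dt _]] : @units S t.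
  rewrite -(subrK 1 t) addrC; apply: jacobson_unit.
  by rewrite /t addrAC; apply: jacobsonB => //; apply: psi_jacobson.
have E1 : mx c 0 (- ract w c) 1 * mx r v w s = mx 1 (c *: v) 0 t.
  rewrite mx_mulE !(pair0, ract0, scale1r, mul1r, addr0) cr.
  by rewrite ractNl ractA cr ract1 addNr mc_psiNl addrC.
have E2 : mx 1 (- ract (c *: v) d) 0 d * mx 1 (c *: v) 0 t = 1.
  rewrite mx_mulE !(pair0, ract0, scale1r, mul1r, addr0, scaler0, add0r) dt.
  by rewrite ractNl ractA dt ract1 subrr.
by exists (mx 1 (- ract (c *: v) d) 0 d * mx c 0 (- ract w c) 1); rewrite -mulrA E1.
Qed.

(** The matrices with radical diagonal form a left ideal, since the extra
    diagonal terms in a product come from [VW] and [WV]; adding [1] to such a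
    matrix makes it left invertible. *)
Lemma mx_jacobsonP A :
  jacobson T A <-> jacobson R (ul A) /\ jacobson S (dr A).
Proof.
split=> [JA|]; first by split;
  [apply: corner_jacobson ul_corner _ JA | apply: corner_jacobson dr_corner _ JA].
case: A => r v w s [/= Jr Js]; apply/jacobsonP => -[r' v' w' s'].
rewrite mx_mulE -[1 + _]/(mx (1 + _) (0 + _) (0 + _) (1 + _)).
by apply: mx_linv; rewrite addrC addKr; apply: jacobsonD;
  do ?[exact: phi_jacobson|exact: psi_jacobson|exact: jacobsonMl].
Qed.

Definition diag_quot (A : jacobson_quot T) : jacobson_quot R * jacobson_quot S :=
  (\pi_(jacobson_quot R) (ul (repr A)), \pi_(jacobson_quot S) (dr (repr A))).

(** The diagonal modulo the radicals depends only on the class of a matrix,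
    by the description of [J(T)]. *)
Lemma diag_quot_pi A :
  diag_quot (\pi_(jacobson_quot T) A) =
  (\pi_(jacobson_quot R) (ul A), \pi_(jacobson_quot S) (dr A)).
Proof.
have /mx_jacobsonP[] : jacobson T (repr (\pi_(jacobson_quot T) A) - A).
  by apply/jquot_eqP; rewrite reprK.
by rewrite !raddfB => /jquot_eqP Er /jquot_eqP Es; congr pair.
Qed.

Lemma diag_quotB : zmod_morphism diag_quot.
Proof.
move=> x y; rewrite -[x]reprK -[y]reprK -jquot_piB !diag_quot_pi.
by congr pair; rewrite raddfB jquot_piB.
Qed.

Lemma diag_quotM : monoid_morphism diag_quot.
Proof.
split=> [|x y]; first by rewrite -jquot_pi1 diag_quot_pi !jquot_pi1.
rewrite -[x]reprK -[y]reprK -jquot_piM !diag_quot_pi.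
case: (repr x) (repr y) => [r v w s] [r' v' w' s'].
congr pair; rewrite -jquot_piM; apply/jquot_eqP => /=.
  by rewrite addrAC subrr add0r; apply: phi_jacobson.
by rewrite addrK; apply: psi_jacobson.
Qed.

Lemma diag_quot_bij : bijective diag_quot.
Proof.
exists (fun x => \pi_(jacobson_quot T) (mx (repr x.1) 0 0 (repr x.2))) => [A|[x y]].
  rewrite -[A in RHS]reprK; apply/jquot_eqP/mx_jacobsonP; rewrite !raddfB.
  by split; apply/jquot_eqP; rewrite /= reprK.
by rewrite diag_quot_pi /= !reprK.
Qed.

Lemma morita_quot_isom :
  ring_isomorphic (jacobson_quot T) (jacobson_quot R * jacobson_quot S)%type.
Proof.
pose f : {rmorphism jacobson_quot T -> (jacobson_quot R * jacobson_quot S)%type} :=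
  HB.pack diag_quot
    (GRing.isZmodMorphism.Build _ _ diag_quot diag_quotB)
    (GRing.isMonoidMorphism.Build _ _ diag_quot diag_quotM).
by exists f; apply: diag_quot_bij.
Qed.

End VW.
End Morita.

Theorem theorem2p8 (R S : pzRingType) (V : bimodType R S) (W : bimodType S R)
    (C : morita_context V W) :
  let T : pzRingType := morita_ring C in
  let cond1 := UJ_ring T in
  let cond2 := [/\ UJ_ring R, UJ_ring S,
                   morita_VW C `<=` jacobson R & morita_WV C `<=` jacobson S] in
  let cond3 := [/\ UJ_ring R, UJ_ring S &
                   ring_isomorphic (jacobson_quot T)
                     (jacobson_quot R * jacobson_quot S)%type] in
  (cond1 <-> cond2) /\ (cond2 <-> cond3).
Proof.
move=> T cond1 cond2 cond3.
have c12 : cond1 -> cond2.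
  move=> UJT; split.
  - exact: corner_UJ (ul_corner C) UJT.
  - exact: corner_UJ (dr_corner C) UJT.
  - exact: UJ_VW UJT.
  - exact: UJ_WV UJT.
have c23 : cond2 -> cond3.
  by case=> UJR UJS VWJ WVJ; split=> //; exact: morita_quot_isom VWJ WVJ.
have c31 : cond3 -> cond1.
  case=> /UJ_quotP UR /UJ_quotP US /units_trivial_isom UT.
  by apply/UJ_quotP; apply: UT; apply: units_pair_trivial.
by split; split; auto.
Qed.
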